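(* Let $r\ge 2$. For integers $n\ge 0$ and $\ell\ge 0$, let $T_{n,\ell}^{(r)}$ be the number of paths in $\mathcal{A}_{n,0}^{(r)}$ containing exactly $\ell$ occurrences of $\mathbf{udu}$. Then $T_{0,0}^{(r)}=1$, and for all integers $n>\ell\ge 0$, $$T_{n,\ell}^{(r)}=\binom{n-1}{\ell}T_{n-\ell,0}^{(r)}r^{\ell},$$ where for $n\ge 1$ $$T_{n,0}^{(r)}=\sum_{j=\lfloor n/2\rfloor}^{n-1}\binom{n-1}{j}\frac{1}{j+1}\binom{j+1}{n-j}r^{n-j}(r-1)^{j}.$$ Moreover, $T_0(x)=\sum_{n\ge0}T_{n,0}^{(r)}x^n$ equals $$T_0(x)=\frac{1+(r-1)x-\sqrt{(1+(r-1)x)^2-4(r-1)(1+rx)x}}{2(r-1)x},$$ and satisfies $T_0(x)=1+rx-(r-1)xT_0(x)+(r-1)xT_0(x)^2$.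
   Context: A Dyck path of length $2n$ is a lattice path from $(0,0)$ to $(2n,0)$ weakly above the $x$-axis with steps $\mathbf{u}=(1,1)$, $\mathbf{d}=(1,-1)$; an $r$-colored Dyck path has each $\mathbf{d}$-step colored with one of $r$ colors. $\mathcal{A}_{n,0}^{(r)}$ is the set of $r$-colored Dyck paths of length $2n$ with no two consecutive $\mathbf{d}$-steps of the same color. An occurrence of $\mathbf{udu}$ is a triple of consecutive steps of the form $\mathbf{u},\mathbf{d},\mathbf{u}$ (regardless of the color of the $\mathbf{d}$-step); occurrences may overlap. *)

(* Defs.v *)
From HB Require Import structures.
From mathcomp Require Import all_boot all_order all_algebra.
From mathcomp Require Import boolp classical_sets.

Set Implicit Arguments.
Unset Strict Implicit.
Unset Printing Implicit Defensive.

Import GRing.Theory.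

Local Open Scope nat_scope.

(* [None] is an up-step, [Some c] is a down-step of color [c].  A lattice path
   from the origin is the sequence of its steps; each step advances the
   abscissa by 1, so the abscissa of the endpoint is the length. *)
Definition step (r : nat) : finType := option 'I_r.

Definition is_up (r : nat) (a : step r) : bool := ~~ isSome a.

Definition height (r : nat) (s : seq (step r)) : int :=
  (\sum_(a <- s) (if is_up a then 1 else -1))%R.

Definition dyck (r : nat) (s : seq (step r)) : bool :=
  (height s == 0)%R
    && all (fun k => 0 <= height (take k s))%R (iota 0 (size s).+1).

(* "Consecutive" means adjacent in the path. *)
Definition no_equal_dd (r : nat) (s : seq (step r)) : bool :=
  sorted (fun a b : step r => ~~ [&& ~~ is_up a, ~~ is_up b & a == b]) s.

Definition occurrences (T : eqType) (w s : seq T) : nat :=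
  count (fun i => prefix w (drop i s)) (iota 0 (size s)).

Definition udu_count (r : nat) (s : seq (step r)) : nat :=
  occurrences [:: true; false; true] (map (@is_up r) s).

Definition Apaths (r n : nat) : {set (n.*2).-tuple (step r)} :=
  [set p : (n.*2).-tuple (step r) | dyck p && no_equal_dd p].

Definition Tnum (r n l : nat) : nat :=
  #|[set p in Apaths r n | udu_count p == l]|.

Local Open Scope ring_scope.

Record fps (F : fieldType) := FPS { fps_coef :> nat -> F }.

Notation "{ 'fps' F }" := (fps F)
  (at level 0, format "{ 'fps'  F }") : type_scope.

Section FPSRing.
Variable F : fieldType.
Implicit Types f g h : {fps F}.

HB.instance Definition _ := gen_eqMixin {fps F}.
HB.instance Definition _ := gen_choiceMixin {fps F}.

Lemma fpsP f g : (forall n, f n = g n) -> f = g.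
Proof. by case: f g => [f] [g] /= /funext ->. Qed.

Definition fps_zero : {fps F} := FPS (fun=> 0).
Definition fps_one : {fps F} := FPS (fun n => (n == 0%N)%:R).
Definition fps_opp f : {fps F} := FPS (fun n => - f n).
Definition fps_add f g : {fps F} := FPS (fun n => f n + g n).
Definition fps_mul f g : {fps F} :=
  FPS (fun n => \sum_(i < n.+1) f i * g (n - i)%N).

Lemma fps_addA : associative fps_add.
Proof. by move=> f g h; apply: fpsP => n /=; rewrite addrA. Qed.
Lemma fps_addC : commutative fps_add.
Proof. by move=> f g; apply: fpsP => n /=; rewrite addrC. Qed.
Lemma fps_add0 : left_id fps_zero fps_add.
Proof. by move=> f; apply: fpsP => n /=; rewrite add0r. Qed.
Lemma fps_addN : left_inverse fps_zero fps_opp fps_add.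
Proof. by move=> f; apply: fpsP => n /=; rewrite addNr. Qed.

HB.instance Definition _ :=
  GRing.isZmodule.Build {fps F} fps_addA fps_addC fps_add0 fps_addN.

Definition fps_trunc N f : {poly F} := \poly_(i < N.+1) f i.

Lemma coef_fps_trunc N f n : (n <= N)%N -> (fps_trunc N f)`_n = f n.
Proof. by move=> le_nN; rewrite coef_poly ltnS le_nN. Qed.

Lemma coef_truncM N f g n :
  (n <= N)%N -> (fps_trunc N f * fps_trunc N g)`_n = fps_mul f g n.
Proof.
move=> le_nN; rewrite coefM; apply: eq_bigr => i _.
rewrite !coef_fps_trunc //; first exact: leq_trans (leq_subr _ _) le_nN.
by apply: leq_trans le_nN; rewrite -ltnS.
Qed.

Lemma fps_mulC : commutative fps_mul.
Proof.
by move=> f g; apply: fpsP => n; rewrite -!(coef_truncM _ _ (leqnn n)) mulrC.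
Qed.

Lemma coef_truncMl (p q : {poly F}) N f n :
    (n <= N)%N -> (forall i, (i <= N)%N -> p`_i = q`_i) ->
  (p * fps_trunc N f)`_n = (q * fps_trunc N f)`_n.
Proof.
move=> le_nN eq_pq; rewrite !coefM; apply: eq_bigr => i _.
by rewrite eq_pq //; apply: leq_trans le_nN; rewrite -ltnS.
Qed.

Lemma fps_mul_trunc3 f g h n :
  fps_mul (fps_mul f g) h n = (fps_trunc n f * fps_trunc n g * fps_trunc n h)`_n.
Proof.
rewrite -(coef_truncM _ _ (leqnn n)); apply: coef_truncMl => // i le_in.
by rewrite coef_fps_trunc // coef_truncM.
Qed.

Lemma fps_mulA : associative fps_mul.
Proof.
move=> f g h; apply: fpsP => n.
by rewrite fps_mulC !fps_mul_trunc3 mulrC mulrA.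
Qed.

Lemma fps_mul1 : left_id fps_one fps_mul.
Proof.
move=> f; apply: fpsP => n /=; rewrite big_ord_recl big1 => [|i _].
  by rewrite subn0 mul1r addr0.
by rewrite mul0r.
Qed.

Lemma fps_mulDl : left_distributive fps_mul fps_add.
Proof.
move=> f g h; apply: fpsP => n /=; rewrite -big_split /=.
by apply: eq_bigr => i _; rewrite mulrDl.
Qed.

Lemma fps_one_neq0 : fps_one != fps_zero.
Proof.
by apply/eqP => /(congr1 (@fps_coef F ^~ 0%N)) /= /eqP; rewrite oner_eq0.
Qed.

HB.instance Definition _ := GRing.Zmodule_isComNzRing.Build {fps F}
  fps_mulA fps_mulC fps_mul1 fps_mulDl fps_one_neq0.

Lemma fps_coef0 n : (0 : {fps F}) n = 0. Proof. by []. Qed.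
Lemma fps_coef1 n : (1 : {fps F}) n = (n == 0%N)%:R. Proof. by []. Qed.
Lemma fps_coefN f n : (- f) n = - f n. Proof. by []. Qed.
Lemma fps_coefD f g n : (f + g) n = f n + g n. Proof. by []. Qed.
Lemma fps_coefM f g n : (f * g) n = \sum_(i < n.+1) f i * g (n - i)%N.
Proof. by []. Qed.

Lemma fps_coefM0 f g : (f * g) 0%N = f 0%N * g 0%N.
Proof. by rewrite fps_coefM big_ord1. Qed.

Lemma fps_rec (Phi : nat -> (nat -> F) -> F) :
  exists f : {fps F}, forall n, f n = Phi n (fun i => if (i < n)%N then f i else 0).
Proof.
pose fix G n : nat -> F :=
  if n is m.+1 then fun i => if i == m then Phi m (G m) else G m i else fun=> 0.
have GE n : G n = fun i => if (i < n)%N then G i.+1 i else 0.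
  elim: n => [|n IHn]; apply/funext => i //=; rewrite eqxx ltnS leq_eqVlt.
  by have [-> | _] := eqVneq i n => //=; rewrite IHn /=; case: ifP; rewrite //= eqxx.
by exists (FPS (fun n => G n.+1 n)) => n /=; rewrite eqxx -GE.
Qed.

Lemma fps_inv_exists f : f 0%N != 0 -> exists g, g * f = 1.
Proof.
move=> f0.
have [g gE] := fps_rec (fun n a =>
  ((n == 0%N)%:R - \sum_(i < n) a i * f (n - i)%N) / f 0%N).
exists g; apply: fpsP => n; rewrite fps_coefM big_ord_recr /= subnn (gE n) divfK //.
under [X in _ - X]eq_bigr => i _ do rewrite ltn_ord.
by rewrite addrC subrK.
Qed.

Definition fps_unit : {pred {fps F}} := [pred f : {fps F} | f 0%N != 0].
Definition fps_inv f : {fps F} :=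
  if f \in fps_unit then xget 0 [set g : {fps F} | g * f = 1]%classic else f.

Lemma fps_mulVf : {in fps_unit, left_inverse 1 fps_inv *%R}.
Proof.
move=> f f_unit; rewrite /fps_inv f_unit.
exact: (xgetPex 0 (P := [set g : {fps F} | g * f = 1]%classic) (fps_inv_exists f_unit)).
Qed.

Lemma fps_unitPl f g : g * f = 1 -> fps_unit f.
Proof.
move/(congr1 (@fps_coef F ^~ 0%N)); rewrite fps_coefM0 fps_coef1 /= => gf1.
by apply/eqP => f0; move/eqP: gf1; rewrite f0 mulr0 eq_sym oner_eq0.
Qed.

Lemma fps_inv_out : {in [predC fps_unit], fps_inv =1 id}.
Proof. by move=> f; rewrite inE /= /fps_inv => /negbTE ->. Qed.

HB.instance Definition _ := GRing.ComNzRing_hasMulInverse.Build {fps F}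
  fps_mulVf fps_unitPl fps_inv_out.

Lemma fps_neq0 f : f != 0 -> exists2 n, f n != 0 & forall i, (i < n)%N -> f i = 0.
Proof.
move=> f_neq0; have ex_n : exists n, f n != 0.
  apply: contrapT => f_eq0; case/negP: f_neq0; apply/eqP/fpsP => n.
  by apply/eqP/negP => /negP fn; apply: f_eq0; exists n.
exists (ex_minn ex_n); case: ex_minnP => n fn min_n // i lt_in.
by apply/eqP; apply: contraTT lt_in; rewrite -leqNgt => /min_n.
Qed.

Lemma fps_mulf_eq0 : GRing.integral_domain_axiom {fps F}.
Proof.
move=> f g fg0; apply/norP => -[/fps_neq0[m fm f_lt] /fps_neq0[n gn g_lt]].
have : (f * g) (m + n)%N = 0 by rewrite fg0.
have lt_m : (m < (m + n).+1)%N by rewrite ltnS leq_addr.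
rewrite fps_coefM (bigD1 (Ordinal lt_m)) //= addKn big1 ?addr0; last first.
  move=> i; rewrite -val_eqE /= neq_ltn => /orP[lt_im | lt_mi].
    by rewrite f_lt ?mul0r.
  by rewrite g_lt ?mulr0 // ltn_subLR ?ltn_add2r // -ltnS.
by move/eqP; rewrite mulf_eq0 (negbTE fm) (negbTE gn).
Qed.

HB.instance Definition _ :=
  GRing.ComUnitRing_isIntegral.Build {fps F} fps_mulf_eq0.

Definition fpsX : {fps F} := FPS (fun n => (n == 1%N)%:R).

(* The square root with constant term 1; see [fps_sqrtP] and
   [fps_sqrt_unique]. *)
Definition fps_sqrt f : {fps F} :=
  xget 0 [set g : {fps F} | g 0%N = 1 /\ g ^+ 2 = f]%classic.

Lemma fps_sqrtP f :
  (2%:R : F) != 0 -> f 0%N = 1 -> fps_sqrt f 0%N = 1 /\ fps_sqrt f ^+ 2 = f.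
Proof.
move=> two_neq0 f0; apply: (@xgetPex _ 0 [set g : {fps F} | g 0%N = 1 /\ g ^+ 2 = f]%classic).
have [g gE] := fps_rec (fun n a => if n == 0%N then 1 else
  (f n - \sum_(i < n.-1) a i.+1 * a (n - i.+1)%N) / 2%:R).
have g0 : g 0%N = 1 by rewrite gE.
exists g; split=> //; apply: fpsP => -[|n].
  by rewrite expr2 fps_coefM0 g0 mulr1 f0.
rewrite expr2 fps_coefM big_ord_recl big_ord_recr /= subn0 subnn g0 mul1r mulr1.
rewrite addrCA -mulr2n -mulr_natr (gE n.+1) /= divfK //.
set s := \sum_(i < n) _; set t := \sum_(i < n) _.
suff -> : t = s by rewrite addrC subrK.
apply: eq_bigr => i _; rewrite /bump /= add1n ltnS ltn_ord subSS.
by rewrite ltnS leq_subr.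
Qed.

Lemma fps_sqrt_unique f g :
  (2%:R : F) != 0 -> g 0%N = 1 -> g ^+ 2 = f -> fps_sqrt f = g.
Proof.
move=> two_neq0 g0 g2; have f0 : f 0%N = 1 by rewrite -g2 expr2 fps_coefM0 g0 mulr1.
have [s0 s2] := fps_sqrtP two_neq0 f0.
have /eqP := s2; rewrite -{2}g2 eqf_sqr => /orP[/eqP // | /eqP sN].
have : fps_sqrt f 0%N = (- g) 0%N by rewrite sN.
rewrite fps_coefN s0 g0 => /eqP.
by rewrite -addr_eq0 -mulr2n (negbTE two_neq0).
Qed.

End FPSRing.

Arguments fpsX {F}.

(* The embedding of power series in their field of fractions, where the
   quotient of two power series lives even if the divisor is not a unit. *)
Notation "f %:F" := (@FracField.tofrac _ f) : ring_scope.

Definition T0 (r : nat) : {fps rat} := FPS (fun n => (Tnum r n 0%N)%:R).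

(* Main.v *)
(* Reading a path step by step, the possible completions depend only on the
   current height and on whether the last steps were [u], [ud] or [dd], up to
   a permutation of the colors.  Marking [udu] by [q] and up-steps by [x], the
   resulting linear recursion in the height is solved by explicit geometric
   sequences in [h], provided that the series [F] of all paths satisfies
     F = 1 + x (r (1 + q (F - 1)) + (r - 1) F (F - 1)),
   whose terms are the factors [A] empty and [A] nonempty of [u A d B].
   Dividing by [1 - r q x] turns this into the equation at [q = 0] in the
   variable [y = x / (1 - r q x)], so [F(x) = T_0(y)], which gives the
   refinement by [l].  In the same way [T_0 - 1] solves [H = a + b H ^ 2] with
   [a = r x / (1 - (r - 1) x)] and [b = (r - 1) x / (1 - (r - 1) x)], hence
   [H = a C(a b)] for the Catalan series [C], which gives the formula. *)
Require Import Defs.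
From mathcomp Require Import all_boot all_order all_algebra.
From mathcomp Require Import ring zify.

Set Implicit Arguments.
Unset Strict Implicit.
Unset Printing Implicit Defensive.

Import GRing.Theory Num.Theory.

Local Open Scope ring_scope.

(** * Power series *)

Section PowerSeries.
Variable K : fieldType.
Implicit Types f g y : {fps K}.

Definition fpsC (a : K) : {fps K} := FPS (fun n => if n == 0%N then a else 0).

Lemma fps_coefMn f k n : (f *+ k) n = f n *+ k.
Proof. by elim: k => // k IH; rewrite !mulrS fps_coefD IH. Qed.

Lemma fps_coefB f g n : (f - g) n = f n - g n.
Proof. by []. Qed.

Lemma fps_coefCM a f n : (fpsC a * f) n = a * f n.
Proof.
rewrite fps_coefM big_ord_recl subn0 big1 ?addr0 //= => i _.
by rewrite mul0r.
Qed.

Lemma fps_natE k : k%:R = fpsC k%:R.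
Proof. by apply: fpsP => -[|n]; rewrite fps_coefMn fps_coef1 //= mul0rn. Qed.

Lemma fpsCM a b : fpsC (a * b) = fpsC a * fpsC b.
Proof. by apply: fpsP => -[|n]; rewrite fps_coefCM //= mulr0. Qed.

Lemma fpsC1 : fpsC 1 = 1.
Proof. by apply: fpsP => -[|n]. Qed.

Lemma fpsCX a k : fpsC (a ^+ k) = fpsC a ^+ k.
Proof. by elim: k => [|k IH]; rewrite ?fpsC1 // !exprS fpsCM IH. Qed.

Lemma fpsC_predn k : (0 < k)%N -> k%:R - 1 = fpsC k.-1%:R.
Proof. by case: k => // k _; rewrite -fps_natE -natr1 addrK. Qed.

Lemma fps_coefX_M0 f : (fpsX * f) 0%N = 0.
Proof. by rewrite fps_coefM0 mul0r. Qed.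

Lemma fps_coefX_MS f n : (fpsX * f) n.+1 = f n.
Proof.
rewrite fps_coefM big_ord_recl mul0r add0r big_ord_recl /= mul1r subn1.
by rewrite big1 ?addr0 // => i _; rewrite mul0r.
Qed.

Lemma fps_coefXn_M k f n : (fpsX ^+ k * f) n = if (n < k)%N then 0 else f (n - k)%N.
Proof.
elim: k n => [|k IH] n; first by rewrite mul1r subn0.
rewrite exprS -mulrA; case: n => [|n]; first exact: fps_coefX_M0.
by rewrite fps_coefX_MS IH subSS.
Qed.

Lemma fps_exp_lt f k n : f 0%N = 0 -> (n < k)%N -> (f ^+ k) n = 0.
Proof.
move=> f0; elim: k n => // k IH n lt_nk.
rewrite exprS fps_coefM big1 // => -[[|i] lt_in] _ /=; first by rewrite f0 mul0r.
by rewrite IH ?mulr0 //; lia.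
Qed.

(** Multiplication by [fpsX] delays [Psi f] by one degree, so each coefficient is determined by
    earlier ones and [f] can be built recursively. *)
Lemma fps_fixpoint (Psi : {fps K} -> {fps K}) :
    (forall f g n, (forall i, (i <= n)%N -> f i = g i) -> Psi f n = Psi g n) ->
  exists f, f = 1 + fpsX * Psi f.
Proof.
move=> causal.
have [f fE] := fps_rec (fun n a => if n is m.+1 then Psi (FPS a) m else 1).
exists f; apply: fpsP => n; rewrite fE fps_coefD fps_coef1.
case: n => [|n]; first by rewrite fps_coefX_M0 addr0.
rewrite fps_coefX_MS add0r; apply: causal => i le_in /=.
by rewrite ltnS le_in.
Qed.

Lemma fps_coefM_congr f f' g g' n :
    (forall i, (i <= n)%N -> f i = f' i) -> (forall i, (i <= n)%N -> g i = g' i) ->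
  (f * g) n = (f' * g') n.
Proof.
move=> eq_f eq_g; rewrite !fps_coefM; apply: eq_bigr => i _.
by rewrite eq_f ?eq_g ?leq_subr // -ltnS.
Qed.

(** The difference of the two equations factors as [(f - g) * (1 - (b + b' * (f + g)))]; the second
    factor has constant term 1, hence is nonzero. *)
Lemma fps_quadratic_unique (a b b' f g : {fps K}) : b 0%N = 0 -> b' 0%N = 0 ->
  f = a + b * f + b' * f ^+ 2 -> g = a + b * g + b' * g ^+ 2 -> f = g.
Proof.
move=> b0 b'0 fE gE.
have: (f - g) * (1 - (b + b' * (f + g))) = 0.
  have ->: (f - g) * (1 - (b + b' * (f + g))) =
    (f - (a + b * f + b' * f ^+ 2)) - (g - (a + b * g + b' * g ^+ 2)) by ring.
  by rewrite -fE -gE !subrr.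
move/eqP; rewrite mulf_eq0 => /orP[|/eqP/(congr1 (fun h : {fps K} => h 0%N))].
  by rewrite subr_eq0 => /eqP.
rewrite fps_coefB fps_coefD fps_coefM0 b0 b'0 mul0r addr0 subr0 => /eqP.
by rewrite oner_eq0.
Qed.

(* The sum is cut at [k = n], which is harmless if [y] has constant term 0 and
   gives a junk value otherwise. *)
Definition fps_comp f y : {fps K} :=
  FPS (fun n => \sum_(k < n.+1) f k * (y ^+ k) n).

Lemma fps_comp_coef f y n N : y 0%N = 0 -> (n <= N)%N ->
  fps_comp f y n = \sum_(k < N.+1) f k * (y ^+ k) n.
Proof.
move=> y0 le_nN; rewrite /= [LHS](big_ord_widen N.+1 (fun k => f k * (y ^+ k) n)) //.
rewrite big_mkcond; apply: eq_bigr => k _; case: ltnP => // lt_nk.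
by rewrite fps_exp_lt ?mulr0.
Qed.

Lemma fps_coefM_comp g f y n : y 0%N = 0 ->
  (g * fps_comp f y) n = \sum_(k < n.+1) f k * (g * y ^+ k) n.
Proof.
move=> y0; rewrite fps_coefM.
under eq_bigr => i _ do rewrite (fps_comp_coef _ y0 (leq_subr i n)) mulr_sumr.
rewrite exchange_big; apply: eq_bigr => k _; rewrite fps_coefM mulr_sumr.
by apply: eq_bigr => i _; rewrite mulrCA.
Qed.

Lemma fps_compM f g y : y 0%N = 0 ->
  fps_comp (f * g) y = fps_comp f y * fps_comp g y.
Proof.
move=> y0; apply: fpsP => n; rewrite fps_coefM_comp //.
transitivity (\sum_(k < n.+1) \sum_(j < n.+1 | (j <= k)%N) f j * g (k - j)%N * (y ^+ k) n).
  apply: eq_bigr => k _; rewrite fps_coefM mulr_suml.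
  by rewrite (big_ord_widen n.+1 (fun j => f j * g (k - j)%N * (y ^+ k) n)).
transitivity (\sum_(j < n.+1) \sum_(k < n.+1 | (j <= k)%N) f j * g (k - j)%N * (y ^+ k) n).
  by rewrite (exchange_big_dep xpredT).
transitivity (\sum_(j < n.+1) \sum_(k < n.+1) f j * g k * (y ^+ (k + j)) n); last first.
  rewrite exchange_big; apply: eq_bigr => k _.
  rewrite [_ * y ^+ k]mulrC fps_coefM_comp // mulr_sumr; apply: eq_bigr => j _.
  by rewrite exprD [RHS]mulrCA mulrA.
apply: eq_bigr => j _.
(* Shifting [k] by [j] matches the two sums, except for the terms with [k + j > n] on the right,
   where [y ^+ (k + j)] has no coefficient of degree [n]. *)
rewrite -(big_mkord (fun k => j <= k)%N (fun k => f j * g (k - j)%N * (y ^+ k) n)).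
rewrite -(big_mkord xpredT (fun k => f j * g k * (y ^+ (k + j)) n)).
have le_j : (j <= n.+1)%N by rewrite ltnW.
rewrite [LHS](@big_cat_nat _ _ _ j) //.
rewrite big_nat_cond big1; last by move=> i; lia.
rewrite -{1}[j : nat]add0n big_addn [RHS](@big_cat_nat _ _ _ (n.+1 - j)) ?leq_subr //.
rewrite [X in _ = _ + X]big_nat_cond [X in _ = _ + X]big1 ?addr0; last first.
  by move=> i le_i; rewrite fps_exp_lt ?mulr0 //; lia.
rewrite /= add0r; apply: eq_big => [i|i _]; [lia | by rewrite addnK].
Qed.

Lemma fps_compD f g y : fps_comp (f + g) y = fps_comp f y + fps_comp g y.
Proof.
apply: fpsP => n; rewrite fps_coefD /= -big_split.
by apply: eq_bigr => k _; rewrite mulrDl.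
Qed.

Lemma fps_compC a y : fps_comp (fpsC a) y = fpsC a.
Proof.
apply: fpsP => n /=; rewrite big_ord_recl big1 => [|i _]; last by rewrite mul0r.
by rewrite fps_coef1 addr0; case: n => [|n] /=; rewrite ?mulr1 ?mulr0.
Qed.

Lemma fps_compX y : y 0%N = 0 -> fps_comp fpsX y = y.
Proof.
move=> y0; apply: fpsP => -[|n] /=; first by rewrite big_ord1 mul0r y0.
rewrite big_ord_recl big_ord_recl /= big1 => [|i _]; last by rewrite mul0r.
by rewrite mul0r add0r mul1r addr0.
Qed.

(** The expansion of [1 / (1 - c x) ^ (k + 1)]. *)
Definition geom_pow (c : K) k : {fps K} := FPS (fun n => 'C(n + k, k)%:R * c ^+ n).

(** By Pascal's rule, one factor [1 - c x] turns [geom_pow c k.+1] into [geom_pow c k]. *)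
Lemma geom_powE c k : geom_pow c k * (1 - fpsC c * fpsX) ^+ k.+1 = 1.
Proof.
have step1 k' : geom_pow c k' * (1 - fpsC c * fpsX)
    = geom_pow c k' - fpsX * (fpsC c * geom_pow c k') by ring.
elim: k => [|k IH].
  rewrite expr1 step1; apply: fpsP => -[|n]; rewrite fps_coefB.
    by rewrite fps_coefX_M0 /= mulr1 subr0.
  by rewrite fps_coefX_MS fps_coefCM /= !bin0 exprS !mul1r subrr.
rewrite exprS mulrA step1 -[RHS]IH; congr (_ * _); apply: fpsP => -[|n].
  by rewrite fps_coefB fps_coefX_M0 /= subr0 !binn.
rewrite fps_coefB fps_coefX_MS fps_coefCM /= (addSnnS n k) (addSn n k.+1) binS natrD exprS.
by ring.
Qed.

Lemma geom_powS c k : geom_pow c k = geom_pow c 0 ^+ k.+1.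
Proof.
have u_neq0 : (1 - fpsC c * fpsX) ^+ k.+1 != 0 :> {fps K}.
  apply/eqP => u0; have := geom_powE c k; rewrite u0 mulr0 => /eqP.
  by rewrite eq_sym oner_eq0.
apply: (mulIf u_neq0); rewrite geom_powE -exprMn -[1 - _]expr1 geom_powE.
by rewrite expr1n.
Qed.

End PowerSeries.

(** * Weights of path completions *)

Section Walks.
Variable r : nat.
Implicit Types (s w : seq (step r)) (c : 'I_r).

(** The Dyck condition for a path starting at height [h], in a form that passes to the tail. *)
Fixpoint walk (h : nat) s : bool :=
  match s with
  | [::] => h == 0%N
  | None :: s' => walk h.+1 s'
  | Some _ :: s' => if h is h'.+1 then walk h' s' else false
  end.

Lemma walkE h s :
  walk h s = (h%:Z + height s == 0)
    && all (fun k => 0 <= h%:Z + height (take k s)) (iota 0 (size s).+1).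
Proof.
elim: s h => [|a s IH] h.
  by rewrite /= /height big_nil addr0 andbT; case: h.
have heightE b s' : height (b :: s') = (if is_up b then 1 else -1) + height s'.
  by rewrite /height big_cons.
have height0 : height (Nil (step r)) = 0 by rewrite /height big_nil.
have allE (P : pred nat) n :
    all P (iota 0 n.+2) = P 0%N && all (fun k => P k.+1) (iota 0 n.+1).
  have -> : iota 0 n.+2 = 0%N :: map S (iota 0 n.+1) by rewrite -(iotaDl 1 0).
  exact: (congr1 (andb _) (all_map S P (iota 0 n.+1))).
have up_shift (k : nat) (z : int) : k%:Z + (1 + z) = k.+1%:Z + z by lia.
have down_shift (k : nat) (z : int) : k.+1%:Z + (-1 + z) = k%:Z + z by lia.
rewrite [size _]/= allE take0 height0 addr0 lez_nat leq0n andTb heightE.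
case: a => [c|]; last first.
  rewrite [is_up _]/= up_shift [walk _ _]/= IH; congr (_ && _).
  by apply: eq_all => k; rewrite [take _ _]/= heightE [is_up _]/= up_shift.
case: h => [|h]; last first.
  rewrite [is_up _]/= down_shift [walk _ _]/= IH; congr (_ && _).
  by apply: eq_all => k; rewrite [take _ _]/= heightE [is_up _]/= down_shift.
(* A down-step from height 0 already makes the prefix of length 1 negative. *)
by rewrite [all _ _]/= take0 heightE height0 andbF.
Qed.

Lemma dyck_walk s : dyck s = walk 0 s.
Proof. by rewrite walkE add0r; congr (_ && _); apply: eq_all => k; rewrite add0r. Qed.

Lemma walk_size h s : walk h s -> (h <= size s)%N.
Proof.
elim: s h => [|[c|] s IH] h /=; first by move/eqP->.
  by case: h => // h /IH.
by move/IH => lt_hs; apply: ltnW (leqW _).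
Qed.

Lemma udu_count_cons (a : step r) s :
  udu_count (a :: s) = (prefix [:: true; false; true] (map (@is_up r) (a :: s)) + udu_count s)%N.
Proof.
rewrite /udu_count /occurrences -(count_map S (fun i => prefix _ (drop i (is_up a :: _)))).
by rewrite -(iotaDl 1 0).
Qed.

Lemma udu_count_d c s : udu_count (Some c :: s) = udu_count s.
Proof. by rewrite udu_count_cons. Qed.

Lemma udu_count_uu s : udu_count (None :: None :: s) = udu_count (None :: s).
Proof. by rewrite udu_count_cons. Qed.

Lemma udu_count_udu c s :
  udu_count [:: None, Some c, None & s] = (udu_count (None :: s)).+1.
Proof. by rewrite udu_count_cons /= prefix0s udu_count_d. Qed.

Lemma udu_count_udd c c' s :
  udu_count [:: None, Some c, Some c' & s] = udu_count (Some c' :: s).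
Proof. by rewrite udu_count_cons /= udu_count_d. Qed.

Variables (K : fieldType) (q : K).

(* The weight of the continuations of length [m] of a path that is at height
   [h] and whose last steps are [p]. *)
Definition weight (p : seq (step r)) h m : K :=
  \sum_(w : m.-tuple (step r) | walk h w && no_equal_dd (p ++ w))
    q ^+ udu_count (p ++ w).

(** * Sums over words, split by the first letter *)

Lemma big_tuple_cons (T : finType) m (P : pred (seq T)) (G : seq T -> K) :
  \sum_(t : m.+1.-tuple T | P t) G t =
  \sum_(a : T) \sum_(t : m.-tuple T | P (a :: t)) G (a :: t).
Proof.
rewrite pair_big_dep /=.
rewrite (reindex (fun x : T * m.-tuple T => [tuple of x.1 :: x.2])) //=.
exists (fun t => (thead t, [tuple of behead t])) => [[a t] _|t _] /=.
  by congr (_, _); apply: val_inj.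
by rewrite -tuple_eta.
Qed.

Lemma big_tuple0 (T : finType) (P : pred (seq T)) (G : seq T -> K) :
  \sum_(t : 0.-tuple T | P t) G t = if P [::] then G [::] else 0.
Proof.
rewrite big_mkcond (big_pred1 [tuple]) // => t.
by rewrite [t]tuple0 /= eqxx.
Qed.

Lemma big_option (T : finType) (G : option T -> K) :
  \sum_(a : option T) G a = G None + \sum_(a : T) G (Some a).
Proof.
rewrite (bigD1 None) //=; congr (_ + _).
rewrite (reindex_omap (@Some T) id) => [|[a|]] //=.
by apply: eq_bigl => a; rewrite eqxx.
Qed.

Lemma weight0 p h : no_equal_dd p ->
  weight p h 0 = if h == 0%N then q ^+ udu_count p else 0.
Proof.
move=> ok_p.
rewrite /weight (big_tuple0 (fun w => walk h w && no_equal_dd (p ++ w))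
  (fun w => q ^+ udu_count (p ++ w))).
by rewrite /= cats0 ok_p andbT.
Qed.

Lemma weightS p h m :
  weight p h m.+1 = \sum_(w : m.-tuple (step r) | walk h.+1 w && no_equal_dd (p ++ None :: w))
    q ^+ udu_count (p ++ None :: w) +
  \sum_(c < r) if h is h'.+1 then
      \sum_(w : m.-tuple (step r) | walk h' w && no_equal_dd (p ++ Some c :: w))
        q ^+ udu_count (p ++ Some c :: w)
    else 0.
Proof.
rewrite /weight (big_tuple_cons _ (fun w => walk h w && no_equal_dd (p ++ w))
  (fun w => q ^+ udu_count (p ++ w))) big_option; congr (_ + _).
by case: h => [|h] //=; apply: eq_bigr => c _; rewrite big1.
Qed.

(** * Recursions for the weights *)

Lemma weight_nil_S m : weight [::] 0 m.+1 = weight [:: None] 1 m.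
Proof. by rewrite weightS [X in _ + X]big1 ?addr0. Qed.

Lemma weight_u_S h m : weight [:: None] h.+1 m.+1 =
  weight [:: None] h.+2 m + \sum_(c < r) weight [:: None; Some c] h m.
Proof.
by rewrite weightS; congr (_ + _); apply: eq_bigr => w _; rewrite /= udu_count_uu.
Qed.

(** An up-step completes a [udu], whence the factor [q]; a down-step must change color, and after it
    the earlier [u] no longer matters. *)
Lemma weight_ud_S c h m : weight [:: None; Some c] h m.+1 =
  q * weight [:: None] h.+1 m +
  if h is h'.+1 then \sum_(c' < r | c' != c) weight [:: Some c'] h' m else 0.
Proof.
rewrite weightS; congr (_ + _).
  by rewrite mulr_sumr; apply: eq_bigr => w _; rewrite [_ ++ _]/= udu_count_udu exprS.
case: h => [|h]; first by rewrite big1.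
rewrite [RHS]big_mkcond; apply: eq_bigr => c' _; case: (eqVneq c' c) => [->|neq] /=.
  by apply: big_pred0 => w; rewrite /no_equal_dd /= eqxx andbF.
apply: eq_big => w; last by rewrite udu_count_udd.
by rewrite /no_equal_dd /= (_ : Some c == Some c' = false) // (inj_eq Some_inj) eq_sym (negbTE neq).
Qed.

Lemma weight_d_S c h m : weight [:: Some c] h m.+1 =
  weight [:: None] h.+1 m +
  if h is h'.+1 then \sum_(c' < r | c' != c) weight [:: Some c'] h' m else 0.
Proof.
rewrite weightS; congr (_ + _).
  by apply: eq_bigr => w _; rewrite [_ ++ _]/= udu_count_d.
case: h => [|h]; first by rewrite big1.
rewrite [RHS]big_mkcond; apply: eq_bigr => c' _; case: (eqVneq c' c) => [->|neq] /=.
  by apply: big_pred0 => w; rewrite /no_equal_dd /= eqxx andbF.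
apply: eq_big => w; last by rewrite udu_count_d.
by rewrite /no_equal_dd /= (_ : Some c == Some c' = false) // (inj_eq Some_inj) eq_sym (negbTE neq).
Qed.

Lemma weight_short p h m : (m < h)%N -> weight p h m = 0.
Proof.
move=> lt_mh; apply: big_pred0 => w; apply/negbTE; apply/negP => /andP[/walk_size].
by rewrite size_tuple leqNgt lt_mh.
Qed.

(* The series of the completions from height [h], where the coefficient [n]
   counts those with [n] up-steps, hence of length [h + 2 n].  [Useries h]
   belongs to height [h + 1], the least possible height after an up-step. *)
Section Solution.
Variable F : {fps K}.
Hypothesis r_gt0 : (0 < r)%N.
Let c1 : {fps K} := r%:R - 1.
Let V := r%:R * (1 + fpsC q * (F - 1)) + c1 * F * (F - 1).
Hypothesis FE : F = 1 + fpsX * V.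

(** A completion after [d] at height [h] is a Dyck path followed by [h] blocks, each a down-step and
    a Dyck path. Each such down-step follows a down-step, whence [r - 1] colors. After [ud], a
    nonempty first Dyck path creates one more [udu]. After [u], the first descent has [r] colors if
    it is immediate and [r - 1] otherwise; these are the two terms of [V]. *)
Let Useries h := (c1 * F) ^+ h * V.
Let UDseries h := (c1 * F) ^+ h * (1 + fpsC q * (F - 1)).
Let Dseries h := (c1 * F) ^+ h * F.

Let XV : fpsX * V = F - 1.
Proof. by rewrite [in RHS]FE addrC addKr. Qed.

Let XU h : fpsX * Useries h = (c1 * F) ^+ h * (F - 1).
Proof. by rewrite mulrCA XV. Qed.

Let U_rec h : Useries h = fpsX * Useries h.+1 + r%:R * UDseries h.
Proof.
by rewrite XU exprS /Useries /UDseries /V; ring.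
Qed.

Let UD_rec0 : UDseries 0 = 1 + fpsC q * (fpsX * Useries 0).
Proof. by rewrite XU /UDseries !mul1r. Qed.

Let UD_recS h : UDseries h.+1 = fpsC q * (fpsX * Useries h.+1) + c1 * Dseries h.
Proof. by rewrite XU /UDseries /Dseries !exprS; ring. Qed.

Let D_rec0 : Dseries 0 = 1 + fpsX * Useries 0.
Proof. by rewrite XU /Dseries !mul1r addrC subrK. Qed.

Let D_recS h : Dseries h.+1 = fpsX * Useries h.+1 + c1 * Dseries h.
Proof. by rewrite XU /Dseries !exprS; ring. Qed.

(** Induction on the length: the weights and the coefficients obey the same recursions. The two
    claims go together because the recursions mix them. *)
Lemma weight_series m :
  (forall h n, m = (h.+1 + n.*2)%N -> weight [:: None] h.+1 m = Useries h n) /\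
  (forall h n c, m = (h + n.*2)%N ->
     weight [:: None; Some c] h m = UDseries h n /\ weight [:: Some c] h m = Dseries h n).
Proof.
have pred_natr : r.-1%:R = r%:R - 1 :> K.
  by rewrite -[in RHS](prednK r_gt0) -natr1 addrK.
have sum_neq c (a : K) : \sum_(c' < r | c' != c) a = (r%:R - 1) * a.
  rewrite sumr_const (_ : #|_| = r.-1); last by rewrite cardC1 card_ord.
  by rewrite -[LHS]mulr_natl pred_natr.
elim: m => [|m [IHU IHD]]; split=> //.
- case=> [|//] [|//] c _; rewrite !weight0 // eqxx UD_rec0 D_rec0 !fps_coefD fps_coefCM.
  by rewrite fps_coefX_M0 mulr0 addr0 udu_count_d.
- move=> h n m_eq; rewrite weight_u_S U_rec fps_coefD fps_natE fps_coefCM.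
  congr (_ + _).
    (* For [n = 0] the remaining length suffices only for descending, so no up-step is possible. *)
    case: n m_eq => [|n] m_eq; first by rewrite fps_coefX_M0 weight_short //; lia.
    by rewrite fps_coefX_MS; apply: IHU; lia.
  rewrite (eq_bigr (fun=> UDseries h n)) ?sumr_const ?card_ord ?mulr_natl // => c _.
  by apply: (IHD h n c _).1; lia.
move=> h n c m_eq.
have Uh : weight [:: None] h.+1 m = (fpsX * Useries h) n.
  case: n m_eq => [|n] m_eq; first by rewrite fps_coefX_M0 weight_short //; lia.
  by rewrite fps_coefX_MS; apply: IHU; lia.
rewrite weight_ud_S weight_d_S Uh.
case: h m_eq {Uh} => [|h] m_eq.
  rewrite UD_rec0 D_rec0 !fps_coefD fps_coefCM !fps_coef1 !addr0.
  by case: n m_eq => [|n] // _; rewrite !add0r.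
have -> : \sum_(c' < r | c' != c) weight [:: Some c'] h m = (c1 * Dseries h) n.
  rewrite /c1 fpsC_predn // fps_coefCM pred_natr -(sum_neq c).
  by apply: eq_bigr => c' _; apply: (IHD h n c' _).2; lia.
by rewrite UD_recS D_recS !fps_coefD fps_coefCM.
Qed.

Lemma weight_nil_series n : weight [::] 0 n.*2 = F n.
Proof.
rewrite [in RHS]FE fps_coefD; case: n => [|n].
  by rewrite weight0 // fps_coefX_M0 addr0.
have [weight_u _] := weight_series n.*2.+1.
by rewrite doubleS weight_nil_S (weight_u 0%N n) // fps_coefX_MS add0r /Useries mul1r.
Qed.

End Solution.

Definition Fser : {fps K} := FPS (fun n => \sum_(p in Apaths r n) q ^+ udu_count p).

Lemma weight_Apaths n : weight [::] 0 n.*2 = Fser n.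
Proof. by apply: eq_bigl => p; rewrite inE dyck_walk. Qed.

(** A solution [F] is first constructed abstractly; the weight recursions then identify it with the
    path series, so no path has to be decomposed. *)
Lemma Fser_eq : (0 < r)%N ->
  Fser = 1 + fpsX * (r%:R * (1 + fpsC q * (Fser - 1)) + (r%:R - 1) * Fser * (Fser - 1)).
Proof.
move=> r_gt0.
have [|F FE] := @fps_fixpoint K (fun F => r%:R * (1 + fpsC q * (F - 1)) + (r%:R - 1) * F * (F - 1)).
  move=> f g n eq_fg.
  have eq_fg1 i : (i <= n)%N -> (f - 1) i = (g - 1) i.
    by move=> le_in; rewrite !fps_coefB eq_fg.
  rewrite !fps_coefD; congr (_ + _).
    apply: fps_coefM_congr => // i le_in; rewrite !fps_coefD; congr (_ + _).
    by rewrite !fps_coefCM eq_fg1.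
  by apply: fps_coefM_congr => // i le_in; apply: fps_coefM_congr => // j le_ji;
    apply: eq_fg; apply: leq_trans le_in.
suff -> : Fser = F by [].
by apply: fpsP => n; rewrite -weight_Apaths (weight_nil_series r_gt0 FE).
Qed.

End Walks.

(** * Catalan numbers *)

Lemma central_binS n : (n.+1 * 'C(n.+1.*2, n.+1) = (4 * n + 2) * 'C(n.*2, n))%N.
Proof.
have := bin_fact (leq_addr n n); have := bin_fact (leq_addr n.+1 n.+1).
rewrite !addKn !addnn doubleS !factS; have := fact_gt0 n.
set A := 'C(_, _); set B := 'C(_, _); set N := n`!; set M := (n.*2)`!.
move=> N_gt0 A_eq B_eq; apply/eqP; rewrite -(eqn_pmul2r (_ : 0 < n.+1 * (N * N))%N) //; last first.
  by rewrite !muln_gt0 N_gt0.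
apply/eqP; transitivity (A * (n.+1 * N * (n.+1 * N)))%N; first by ring.
by rewrite A_eq -B_eq -muln2; ring.
Qed.

(** Both sides are the trinomial coefficient [m! / (k! k! (m - 2k)!)]. *)
Lemma bin_catalan m k : (k.*2 <= m)%N ->
  ('C(m, k) * 'C(m - k, k) = 'C(m, k.*2) * 'C(k.*2, k))%N.
Proof.
move=> le_km; have le_k : (k <= m)%N by lia.
have lek : (k <= m - k)%N by lia.
have E1 := bin_fact le_k; have E2 := bin_fact lek; have E3 := bin_fact le_km.
have E4 := bin_fact (leq_addr k k); rewrite addKn addnn in E4.
rewrite (_ : m - k - k = m - k.*2)%N in E2; last by lia.
have pos : (0 < k`! * k`! * (m - k.*2)`!)%N by rewrite !muln_gt0 !fact_gt0.
apply/eqP; rewrite -(eqn_pmul2r pos); apply/eqP; transitivity m`!.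
  by rewrite -E1 -E2; ring.
by rewrite -E3 -E4; ring.
Qed.

Section Catalan.
Variables (C : {fps rat}).
Hypothesis CE : C = 1 + fpsX * C ^+ 2.

(* [s = sqrt (1 - 4 x)] satisfies [(1 - 4 x) (x s') = - 2 x s]. *)
Lemma catalan_rec n : (n.+2)%:R * C n.+1 = (4 * n + 2)%:R * C n.
Proof.
pose s : {fps rat} := 1 - 2%:R * (fpsX * C).
have s2 : s ^+ 2 = 1 - 4%:R * fpsX.
  have ->: s ^+ 2 = 1 - 4%:R * fpsX * (C - fpsX * C ^+ 2) by rewrite /s; ring.
  by rewrite (_ : C - _ = 1) ?mulr1 // {1}CE addrK.
(* The derivation [x d/dx]. *)
pose theta (f : {fps rat}) : {fps rat} := FPS (fun n => n%:R * f n).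
have thetaE f k : theta f k = k%:R * f k by [].
have thetaM f g : theta (f * g) = theta f * g + f * theta g.
  apply: fpsP => k; rewrite fps_coefD /= mulr_sumr -big_split /=.
  apply: eq_bigr => i _; have -> : k%:R = i%:R + (k - i)%:R :> rat.
    by rewrite -natrD subnKC // -ltnS.
  by ring.
have s_ode : (1 - 4%:R * fpsX) * theta s = - (2%:R * (fpsX * s)).
  have s_neq0 : s != 0.
    apply/eqP => /(congr1 (fun f : {fps rat} => f 0%N)).
    rewrite fps_coefB fps_natE fps_coefCM fps_coefX_M0 mulr0 subr0 => /eqP.
    by rewrite oner_eq0.
  have two_neq0 : 2%:R != 0 :> {fps rat}.
    by rewrite fps_natE; apply/eqP => /(congr1 (fun f : {fps rat} => f 0%N)).
  (* The factor [2 s] turns [theta s] into [theta (s ^+ 2)], which is explicit. *)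
  apply: (mulfI two_neq0); apply: (mulIf s_neq0).
  have -> : 2%:R * ((1 - 4%:R * fpsX) * theta s) * s =
    (1 - 4%:R * fpsX) * (theta s * s + s * theta s) by ring.
  rewrite -thetaM -expr2 s2 (_ : theta _ = - (4%:R * fpsX)); last first.
    apply: fpsP => k; rewrite fps_coefN fps_natE fps_coefCM.
    rewrite thetaE fps_coefB fps_coefCM fps_coef1.
    by case: k => [|[|k]] /=; ring.
  by rewrite -s2; ring.
have sS k : s k.+1 = - (2%:R * C k).
  by rewrite fps_coefB fps_natE fps_coefCM fps_coefX_MS sub0r.
have := congr1 (fun f : {fps rat} => f n.+2) s_ode.
have -> : (1 - 4%:R * fpsX) * theta s = theta s - 4%:R * (fpsX * theta s) by ring.
rewrite fps_coefN fps_coefB !fps_natE !fps_coefCM !fps_coefX_MS !thetaE !sS => E.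
apply: (mulfI (_ : 2%:R != 0 :> rat)) => //.
apply/eqP; rewrite -subr_eq0; apply/eqP.
move/eqP: E; rewrite -subr_eq0 -oppr_eq0 => /eqP <-.
by ring.
Qed.

Lemma catalanE n : C n = 'C(n.*2, n)%:R / n.+1%:R.
Proof.
elim: n => [|n IH].
  by rewrite CE fps_coefD fps_coefX_M0 addr0.
have n2 : n.+2%:R != 0 :> rat by rewrite pnatr_eq0.
have n1 : n.+1%:R != 0 :> rat by rewrite pnatr_eq0.
apply: (mulfI n2); rewrite catalan_rec IH mulrC [RHS]mulrC divfK //.
apply: (mulfI n1); rewrite -natrM central_binS natrM mulrA [_ * (_ / _)]mulrC divfK //.
by rewrite mulrC.
Qed.

End Catalan.

(** * Counting by occurrences of udu *)

Section UduSeries.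
Variables (r : nat) (K : fieldType).
Hypothesis r_gt0 : (0 < r)%N.

Definition Tser : {fps K} := FPS (fun n => (Tnum r n 0)%:R).

(** As [0 ^+ 0 = 1], exactly the paths without [udu] survive. *)
Lemma Fser_q0 : Fser r 0 = Tser.
Proof.
apply: fpsP => n /=; rewrite /Tnum -sum1_card natr_sum.
rewrite [RHS](eq_bigl (fun p => (p \in Apaths r n) && (udu_count p == 0%N))); last first.
  by move=> p; rewrite inE.
rewrite [RHS]big_mkcondr; apply: eq_bigr => p _.
by rewrite expr0n; case: eqP.
Qed.

Lemma Tser_eq :
  Tser = 1 + r%:R * fpsX - (r%:R - 1) * fpsX * Tser + (r%:R - 1) * fpsX * Tser ^+ 2.
Proof.
have := Fser_eq (0 : K) r_gt0; rewrite Fser_q0 => {1}->.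
have -> : fpsC 0 = 0 :> {fps K} by apply: fpsP => -[].
by ring.
Qed.

(** With [y = x / (1 - r q x)], both sides solve [H = 1 + r y - (r - 1) y H + (r - 1) y H ^ 2],
    whose solution is unique since [y] has constant term 0. *)
Lemma Fser_comp (q : K) :
  Fser r q = fps_comp Tser (fpsX * geom_pow (r%:R * q) 0).
Proof.
set e := geom_pow _ 0; set F := Fser r q; set c : {fps K} := r%:R - 1.
have y0 : (fpsX * e) 0%N = 0 by exact: fps_coefX_M0.
have eE : e * (1 - r%:R * fpsC q * fpsX) = 1.
  by rewrite fps_natE -fpsCM -[1 - _]expr1; exact: geom_powE.
apply: (@fps_quadratic_unique _ (1 + r%:R * (fpsX * e)) (- c * (fpsX * e)) (c * (fpsX * e))).
- by rewrite mulrCA fps_coefX_M0.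
- by rewrite mulrCA fps_coefX_M0.
- have FE := Fser_eq q r_gt0; rewrite -/F -/c in FE.
  have : e * (F - (1 + fpsX * (r%:R * (1 + fpsC q * (F - 1)) + c * F * (F - 1)))) = 0.
    by rewrite -FE subrr mulr0.
  have -> : e * (F - (1 + fpsX * (r%:R * (1 + fpsC q * (F - 1)) + c * F * (F - 1)))) =
    e * (1 - r%:R * fpsC q * fpsX) * (F - 1) - fpsX * e * (r%:R + c * F * (F - 1)) by ring.
  rewrite eE mul1r => /eqP; rewrite subr_eq0 => /eqP E.
  by rewrite -[LHS](subrK 1) E; ring.
have TE : Tser = fpsC 1 + fpsC r%:R * fpsX + - (c * fpsX) * Tser + c * fpsX * (Tser * Tser).
  by rewrite {1}Tser_eq fpsC1 -fps_natE -/c; ring.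
have CN : fpsC (- r.-1%:R) = - fpsC r.-1%:R :> {fps K}.
  by apply: fpsP => -[|n]; rewrite fps_coefN //= oppr0.
rewrite {1}TE /c fpsC_predn // -mulNr -CN.
rewrite !fps_compD !fps_compM // !fps_compC fps_compX // -fps_natE fpsC1 CN.
by ring.
Qed.

Lemma Fser_coef (q : K) n :
  Fser r q n.+1 =
  \sum_(l < n.+1) ('C(n, l) * Tnum r (n.+1 - l) 0 * r ^ l)%:R * q ^+ l.
Proof.
rewrite Fser_comp -[fps_comp _ _]mul1r fps_coefM_comp ?fps_coefX_M0 //.
rewrite big_ord_recl mul1r fps_coef1 mulr0 add0r.
(* The term of [y ^+ k.+1] contributes [q] to the power [l = n - k]. *)
rewrite [RHS](reindex_inj rev_ord_inj); apply: eq_bigr => k _.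
have le_kn : (k <= n)%N by rewrite -ltnS.
rewrite lift0 mul1r exprMn -geom_powS fps_coefXn_M ltnS ltnNge le_kn /=.
rewrite !subSS subnK // subSn ?leq_subr // subKn // bin_sub //.
by rewrite exprMn !natrM natrX; ring.
Qed.

End UduSeries.

(** * Closed formulas for the numbers of paths and for their series *)

Lemma Tnum_udu r n l : (0 < r)%N -> (l < n)%N ->
  Tnum r n l = ('C(n - 1, l) * Tnum r (n - l) 0 * r ^ l)%N.
Proof.
case: n => // n r_gt0 lt_ln; rewrite subSS subn0.
(* Here [q] is an indeterminate, made an element of a field; both sides come from polynomials, whose
   coefficients at [l] are then compared. *)
have := Fser_coef r_gt0 ('X%:F : {fraction {poly rat}}) n.
pose P : {poly rat} := \sum_(p in Apaths r n.+1) 'X ^+ udu_count p.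
pose Q : {poly rat} := \poly_(k < n.+1) ('C(n, k) * Tnum r (n.+1 - k) 0 * r ^ k)%:R.
have -> : Fser r ('X%:F : {fraction {poly rat}}) n.+1 = P%:F.
  by rewrite rmorph_sum; apply: eq_bigr => p _; rewrite rmorphXn.
have -> : \sum_(k < n.+1) ('C(n, k) * Tnum r (n.+1 - k) 0 * r ^ k)%:R * 'X%:F ^+ k = Q%:F.
  rewrite /Q poly_def rmorph_sum; apply: eq_bigr => k _.
  rewrite -mul_polyC polyC_natr [RHS]rmorphM.
  by rewrite [X in _ = X * _]rmorph_nat [X in _ = _ * X]rmorphXn.
move=> /eqP; rewrite tofrac_eq => /eqP /(congr1 (fun p : {poly rat} => p`_l)).
rewrite coef_poly lt_ln coef_sum => E; apply/eqP; rewrite -(eqr_nat rat) -E.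
rewrite /Tnum -sum1_card natr_sum; apply/eqP.
rewrite (eq_bigl (fun p => (p \in Apaths r n.+1) && (udu_count p == l))); last first.
  by move=> p; rewrite inE.
by rewrite big_mkcondr; apply: eq_bigr => p _; rewrite coefXn eq_sym; case: eqP.
Qed.

Lemma Tnum_catalan r n : (0 < r)%N ->
  (Tnum r n.+1 0)%:R = \sum_(k < n.+1)
    'C(n, k.*2)%:R * ('C(k.*2, k)%:R / k.+1%:R) * r%:R ^+ k.+1 * (r%:R - 1) ^+ (n - k) :> rat.
Proof.
move=> r_gt0; pose T : {fps rat} := Tser r rat.
have TE : T = _ := Tser_eq rat r_gt0.
have [C CE] : exists C : {fps rat}, C = 1 + fpsX * C ^+ 2.
  apply: (@fps_fixpoint rat (fun f => f ^+ 2)) => f g m eq_fg.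
  by rewrite !expr2; apply: fps_coefM_congr.
pose c : rat := r%:R - 1; pose e := geom_pow c 0.
have cE : r%:R - 1 = fpsC c by rewrite fpsC_predn // /c -[in RHS](prednK r_gt0) -natr1 addrK.
have eE : e * (1 - fpsC c * fpsX) = 1 by rewrite -[1 - _]expr1; exact: geom_powE.
pose a : {fps rat} := r%:R * (fpsX * e); pose b := fpsC c * (fpsX * e).
have b0 : b 0%N = 0 by rewrite fps_coefCM fps_coefX_M0 mulr0.
have y0 : (a * b) 0%N = 0 by rewrite fps_coefM0 b0 mulr0.
have T1E : T - 1 = a * fps_comp C (a * b).
  apply: (@fps_quadratic_unique _ a 0 b) => //.
    have : e * (T - (1 + r%:R * fpsX - (r%:R - 1) * fpsX * T + (r%:R - 1) * fpsX * T ^+ 2)) = 0.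
      by rewrite -TE subrr mulr0.
    rewrite cE.
    have -> : e * (T - (1 + r%:R * fpsX - fpsC c * fpsX * T + fpsC c * fpsX * T ^+ 2)) =
      e * (1 - fpsC c * fpsX) * (T - 1) - (a + 0 * (T - 1) + b * (T - 1) ^+ 2).
      by rewrite /a /b; ring.
    by rewrite eE mul1r => /eqP; rewrite subr_eq0 => /eqP.
  (* The Catalan equation at [a * b], multiplied by [a], is [H = a + b H ^ 2]. *)
  have : fps_comp C (a * b) = 1 + a * b * (fps_comp C (a * b) * fps_comp C (a * b)).
    rewrite {1}CE -fpsC1 expr2 fps_compD !fps_compM // fps_compC fps_compX //.
  move: (fps_comp C _) => z zE; rewrite {1}zE; ring.
have -> : (Tnum r n.+1 0)%:R = (T - 1) n.+1 by rewrite fps_coefB subr0.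
rewrite T1E fps_coefM_comp // big_ord_recr.
have coef_k k : (a * (a * b) ^+ k) n.+1 = 'C(n, k.*2)%:R * r%:R ^+ k.+1 * c ^+ (n - k).
  have -> : a * (a * b) ^+ k =
      fpsC (r%:R ^+ k.+1 * c ^+ k) * (fpsX ^+ k.*2.+1 * geom_pow c k.*2).
    rewrite geom_powS fpsCM !fpsCX -fps_natE /a /b -/e -addnn !exprS !exprD !exprMn.
    by ring.
  rewrite fps_coefCM fps_coefXn_M ltnS; case: ltnP => [lt_nk|le_kn].
    by rewrite bin_small // mulr0 !mul0r.
  rewrite subSS /= subnK // (_ : n - k = k + (n - k.*2))%N; last by lia.
  by rewrite exprD; ring.
(* The last term, [k = n + 1], vanishes because [2 k > n]. *)
rewrite coef_k bin_small /= ?mul0r ?mulr0 ?addr0; last by lia.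
by apply: eq_bigr => k _; rewrite [X in _ * X]coef_k (catalanE CE); ring.
Qed.

(** With [j = n - k], absorption gives ['C(j + 1, k + 1) / (j + 1) = 'C(j, k) / (k + 1)]; then
    [bin_catalan] applies. *)
Lemma bin_catalan_rev n k : (k <= n)%N ->
  'C(n, n - k)%:R * (1 / (n - k + 1)%:R) * 'C(n - k + 1, n.+1 - (n - k))%:R =
  'C(n, k.*2)%:R * ('C(k.*2, k)%:R / k.+1%:R) :> rat.
Proof.
move=> le_kn; rewrite bin_sub // addn1 subSn ?leq_subr // subKn //.
have n1 : (n - k).+1%:R != 0 :> rat by rewrite pnatr_eq0.
have k1 : k.+1%:R != 0 :> rat by rewrite pnatr_eq0.
have E1 : k.+1%:R * 'C((n - k).+1, k.+1)%:R = (n - k).+1%:R * 'C(n - k, k)%:R :> rat.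
  by rewrite -!natrM mul_bin_diag.
have E2 : 'C(n, k)%:R * 'C(n - k, k)%:R = 'C(n, k.*2)%:R * 'C(k.*2, k)%:R :> rat.
  rewrite -!natrM; case: (leqP k.*2 n) => [/bin_catalan -> //|lt_nk].
  by rewrite (@bin_small (n - k)) ?(@bin_small n k.*2) ?muln0 //; lia.
apply: (mulfI k1); apply: (mulfI n1).
transitivity ('C(n, k)%:R * (k.+1%:R * 'C((n - k).+1, k.+1)%:R) : rat).
  by field; rewrite addrC natr1.
by rewrite E1 mulrCA E2; field; rewrite addrC natr1.
Qed.

Lemma Tnum_udu0 r n : (0 < r)%N -> (1 <= n)%N ->
  (Tnum r n 0)%:R =
  \sum_(n./2 <= j < n)
     'C(n - 1, j)%:R * (1 / (j + 1)%:R) * 'C(j + 1, n - j)%:R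
     * r%:R ^+ (n - j) * (r%:R - 1) ^+ j :> rat.
Proof.
case: n => // n r_gt0 _; rewrite Tnum_catalan // subSS subn0.
pose f j : rat := 'C(n, j)%:R * (1 / (j + 1)%:R) * 'C(j + 1, n.+1 - j)%:R
  * r%:R ^+ (n.+1 - j) * (r%:R - 1) ^+ j.
rewrite -[RHS]/(\sum_(n.+1./2 <= j < n.+1) f j).
(* Below the lower bound [j + 1 < n + 1 - j], so the second binomial coefficient is 0. *)
have -> : \sum_(n.+1./2 <= j < n.+1) f j = \sum_(j < n.+1) f j.
  rewrite -(big_mkord xpredT f) [RHS](@big_cat_nat _ _ _ n.+1./2) //=; last by lia.
  rewrite [X in _ = X + _]big_nat_cond [X in _ = X + _]big1 ?add0r // => j lt_j.
  by rewrite /f ['C(j + 1, _)]bin_small ?mulr0 ?mul0r //; lia.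
rewrite [RHS](reindex_inj rev_ord_inj); apply: eq_bigr => k _ /=.
have le_kn : (k <= n)%N by rewrite -ltnS.
by rewrite /f subSS bin_catalan_rev // subSn ?leq_subr // subKn.
Qed.

Lemma T0_sqrt r : (2 <= r)%N ->
  (T0 r)%:F =
    (1 + (r%:R - 1) * fpsX
     - fps_sqrt ((1 + (r%:R - 1) * fpsX) ^+ 2
                 - 4%:R * (r%:R - 1) * (1 + r%:R * fpsX) * fpsX))%:F
    / (2%:R * (r%:R - 1) * fpsX)%:F.
Proof.
move=> r_ge2; have r_gt0 : (0 < r)%N by apply: ltnW.
have TE : T0 r = _ := Tser_eq rat r_gt0.
pose c : {fps rat} := r%:R - 1; rewrite -/c in TE *.
set D : {fps rat} := 2%:R * c * fpsX.
have D_neq0 : D != 0.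
  apply/eqP => /(congr1 (fun f : {fps rat} => f 1%N)).
  rewrite /D -mulrA /c fpsC_predn // fps_natE !fps_coefCM /= mulr1 => /eqP.
  by rewrite mulf_eq0 !pnatr_eq0 /=; lia.
(* Completing the square: this series squares to the discriminant, and its constant term 1 selects
   the sign of the root. *)
rewrite (@fps_sqrt_unique _ _ (1 + c * fpsX - D * T0 r)) //.
- rewrite opprB addrC subrK rmorphM mulrC mulKf //.
  by rewrite tofrac_eq0.
- rewrite -[c * fpsX]mulrC /D [_ * fpsX]mulrC -mulrA fps_coefB fps_coefD !fps_coefX_M0.
  by rewrite addr0 subr0.
have E : T0 r - (1 + r%:R * fpsX - c * fpsX * T0 r + c * fpsX * T0 r ^+ 2) = 0.
  by rewrite -TE subrr.
apply/eqP; rewrite -subr_eq0; apply/eqP.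
transitivity (- 4%:R * c * fpsX * (T0 r - (1 + r%:R * fpsX - c * fpsX * T0 r + c * fpsX * T0 r ^+ 2))).
  by rewrite /D; ring.
by rewrite E mulr0.
Qed.

Unset Implicit Arguments.

Theorem theorem6p1 (r : nat) (r_ge2 : (2 <= r)%N) :
  [/\ Tnum r 0 0 = 1%N,
      forall n l : nat, (l < n)%N ->
        Tnum r n l = ('C(n - 1, l) * Tnum r (n - l) 0 * r ^ l)%N,
      forall n : nat, (1 <= n)%N ->
        (Tnum r n 0)%:R =
        \sum_(n./2 <= j < n)
           'C(n - 1, j)%:R * (1 / (j + 1)%:R) * 'C(j + 1, n - j)%:R
           * r%:R ^+ (n - j) * (r%:R - 1) ^+ j :> rat,
      (T0 r)%:F =
        (1 + (r%:R - 1) * fpsX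
         - fps_sqrt ((1 + (r%:R - 1) * fpsX) ^+ 2
                     - 4%:R * (r%:R - 1) * (1 + r%:R * fpsX) * fpsX))%:F
        / (2%:R * (r%:R - 1) * fpsX)%:F
    & T0 r = 1 + r%:R * fpsX - (r%:R - 1) * fpsX * T0 r
             + (r%:R - 1) * fpsX * T0 r ^+ 2].
Proof.
have r_gt0 : (0 < r)%N by apply: ltnW.
split.
(* The value at [n = 0] is the constant term of the functional equation. *)
- apply/eqP; rewrite -(eqr_nat rat) -[_%:R]/(Tser r rat 0%N) -Fser_q0 Fser_eq //.
  by rewrite fps_coefD fps_coefX_M0 addr0.
- by move=> n l; apply: Tnum_udu.
- by move=> n; apply: Tnum_udu0.
- exact: T0_sqrt.
exact: (Tser_eq rat r_gt0).
Qed.
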